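(* Let $d\ge 1$ and let $A=(A_{ij})_{i,j=1}^{N_{vi}}$ be the stiffness matrix of the linear finite element approximation, on an arbitrary simplicial mesh $\mathcal{T}_h$ of $\Omega\subset\mathbb{R}^d$, of the boundary value problem $-\nabla\cdot(\mathbb{D}\nabla u)=f$ in $\Omega$, $u=0$ on $\partial\Omega$ (see context). Then $$\max_j A_{jj}\;\le\;\lambda_{\max}(A)\;\le\;(d+1)\max_j A_{jj}.$$ Moreover, if $S=\mathrm{diag}(s_1,\dots,s_{N_{vi}})$ with $s_j=\sqrt{A_{jj}}$ (Jacobi preconditioning), then the largest eigenvalue of the diagonally preconditioned stiffness matrix has the mesh-independent bound $$1\;\le\;\lambda_{\max}(S^{-1}AS^{-1})\;\le\;d+1.$$
   Context: $\Omega\subset\mathbb{R}^d$ is a simply connected polygonal or polyhedral domain. The diffusion matrix $\mathbb{D}=\mathbb{D}(\boldsymbol{x})$ is a symmetric positive definite $d\times d$ matrix for which there are constants $d_{\min},d_{\max}>0$ with $d_{\min}I\le\mathbb{D}(\boldsymbol{x})\le d_{\max}I$ for all $\boldsymbol{x}\in\Omega$ (in the sense that differences are positive semidefinite). $\mathcal{T}_h$ is a simplicial decomposition (triangulation) of $\overline\Omega$ into finitely many nondegenerate $d$-simplices $K$, as used for conforming linear finite elements, with at least one interior vertex; no assumption on the shape or size of the elements is made. The interior vertices (those not on $\partial\Omega$) are numbered $1,\dots,N_{vi}$, and $\phi_j$ is the continuous function that is affine on each element, equals $1$ at vertex $j$ and $0$ at all other vertices. $|K|$ is the volume of $K$ and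 $\mathbb{D}_K=\frac1{|K|}\int_K\mathbb{D}(\boldsymbol{x})\,d\boldsymbol{x}$. The stiffness matrix is $$A_{ij}=\sum_{K\in\mathcal{T}_h}|K|\,\nabla\phi_i|_K\cdot\mathbb{D}_K\nabla\phi_j|_K,\qquad i,j=1,\dots,N_{vi}.$$ Maxima over $j$ are over $j=1,\dots,N_{vi}$; $\lambda_{\max}$ denotes the largest eigenvalue. *)

(* Defs.v *)
From HB Require Import structures.
From mathcomp Require Import all_boot all_order all_algebra.
From mathcomp Require Import all_classical all_reals all_analysis.
Import Order.TTheory GRing.Theory Num.Theory.
Import numFieldNormedType.Exports.

Set Implicit Arguments.
Unset Strict Implicit.
Unset Printing Implicit Defensive.

Local Open Scope classical_set_scope.
Local Open Scope ring_scope.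

(* Borel sigma-algebra of R^n, generated by the coordinates *)
Section borel_rV.
Context (R : realType) (n : nat).

Let coord (i : 'I_n) (x : 'rV[R]_n) : R := x ord0 i.

Let rV_set0 : g_sigma_preimage coord set0.
Proof. exact: sigma_algebra0. Qed.

Let rV_setC A : g_sigma_preimage coord A -> g_sigma_preimage coord (~` A).
Proof. exact: sigma_algebraC. Qed.

Let rV_bigcup (F : _^nat) : (forall i, g_sigma_preimage coord (F i)) ->
  g_sigma_preimage coord (\bigcup_i (F i)).
Proof. exact: sigma_algebra_bigcup. Qed.

HB.instance Definition _ := @isMeasurable.Build default_measure_display
  'rV[R]_n (g_sigma_preimage coord) rV_set0 rV_setC rV_bigcup.

End borel_rV.

Lemma measurable_coord (R : realType) n (i : 'I_n) :
  measurable_fun [set: 'rV[R]_n] (fun x : 'rV[R]_n => x ord0 i).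
Proof.
move=> _ Y mY; rewrite setTI; apply: sub_sigma_algebra => /=.
rewrite -bigcup_seq/=; exists i => /=; first by rewrite mem_index_enum.
by exists Y => //; rewrite setTI.
Qed.

Lemma measurable_fun_rVP d (T : measurableType d) (R : realType) n
    (f : T -> 'rV[R]_n) :
  (forall i, measurable_fun [set: T] (fun t => f t ord0 i)) ->
  measurable_fun [set: T] f.
Proof.
move=> mf.
have H : g_sigma_preimage (fun i => (fun x : 'rV[R]_n => x ord0 i) \o f)
    `<=` measurable.
  apply: smallest_sub; first exact: sigma_algebra_measurable.
  move=> A; rewrite -bigcup_seq/= => -[i _ [B mB <-]].
  exact: mf.
move=> _ A mA; apply: H; rewrite g_sigma_preimage_comp.
by exists A.
Qed.

Definition rV_cons (R : realType) n (p : measurableTypeR R * 'rV[R]_n) :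
    'rV[R]_n.+1 :=
  row_mx (const_mx p.1 : 'rV_1) p.2.

Lemma rV_cons0 (R : realType) n (p : measurableTypeR R * 'rV[R]_n) :
  rV_cons p ord0 ord0 = p.1.
Proof.
have -> : ord0 = lshift n ord0 :> 'I_(1 + n) by exact/val_inj.
by rewrite /rV_cons (row_mxEl (const_mx p.1 : 'rV_1) p.2) mxE.
Qed.

Lemma rV_consS (R : realType) n (p : measurableTypeR R * 'rV[R]_n) i :
  rV_cons p ord0 (lift ord0 i) = p.2 ord0 i.
Proof.
have -> : lift ord0 i = rshift 1 i :> 'I_(1 + n) by exact/val_inj.
by rewrite /rV_cons (row_mxEr (const_mx p.1 : 'rV_1) p.2).
Qed.

Lemma measurable_rV_cons (R : realType) n :
  measurable_fun [set: measurableTypeR R * 'rV[R]_n] (@rV_cons R n).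
Proof.
apply: measurable_fun_rVP => i; case: (unliftP ord0 i) => [j|] ->.
  under eq_fun do rewrite rV_consS.
  exact: (measurableT_comp (@measurable_coord R n j)).
under eq_fun do rewrite rV_cons0.
exact: measurable_fst.
Qed.

Definition rV_uncons (R : realType) n (x : 'rV[R]_n.+1) :
    measurableTypeR R * 'rV[R]_n :=
  (x ord0 ord0, \row_i x ord0 (lift ord0 i)).

Lemma rV_consK (R : realType) n : cancel (@rV_cons R n) (@rV_uncons R n).
Proof.
case=> a v; rewrite /rV_uncons rV_cons0; congr pair.
by apply/rowP => i; rewrite mxE rV_consS.
Qed.

Lemma measurable_rV_uncons (R : realType) n :
  measurable_fun [set: 'rV[R]_n.+1] (@rV_uncons R n).
Proof.
apply/measurable_fun_pairP; split; first exact: measurable_coord.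
apply: measurable_fun_rVP => i; rewrite /=.
under eq_fun do rewrite mxE.
exact: measurable_coord.
Qed.

Section lebesgue_step.
Context (R : realType) (n : nat).
Variable mu : {sigma_finite_measure set 'rV[R]_n -> \bar R}.

Definition lebesgue_step : set 'rV[R]_n.+1 -> \bar R :=
  pushforward (lebesgue_measure \x mu)%E (@rV_cons R n).

HB.instance Definition _ := Measure.copy lebesgue_step
  (measure_function_pushforward__canonical__measure_function_Measure
    (lebesgue_measure \x mu)%E (@measurable_rV_cons R n)).

Let sigma_finite_step : sigma_finite setT lebesgue_step.
Proof.
have /sigma_finiteP[F [TF ndF Foo]] := sigma_finiteT (@lebesgue_measure R).
have /sigma_finiteP[G [TG ndG Goo]] := sigma_finiteT mu.
exists (fun k => @rV_uncons R n @^-1` (F k `*` G k)).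
  apply/esym; rewrite -subTset => x _.
  have [k _ Fk] : (\bigcup_k F k) (rV_uncons x).1 by rewrite -TF.
  have [l _ Gl] : (\bigcup_k G k) (rV_uncons x).2 by rewrite -TG.
  exists (maxn k l) => //; split.
  - by move: Fk; exact/subsetPset/ndF/leq_maxl.
  - by move: Gl; exact/subsetPset/ndG/leq_maxr.
move=> k; have [mF Fk] := Foo k; have [mG Gk] := Goo k; split.
  rewrite -[X in measurable X]setTI.
  by apply: measurable_rV_uncons => //; exact: measurableX.
rewrite /lebesgue_step /pushforward -comp_preimage.
rewrite (_ : _ \o _ = id); last by apply/funext => p /=; rewrite rV_consK.
by rewrite preimage_id product_measure1E// lte_mul_pinfty// ge0_fin_numE.
Qed.

HB.instance Definition _ :=
  Measure_isSigmaFinite.Build _ _ _ lebesgue_step sigma_finite_step.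

End lebesgue_step.

Section lebesgue_rV0.
Context (R : realType).

Definition lebesgue_rV0 : set 'rV[R]_0 -> \bar R := dirac (0 : 'rV[R]_0).

HB.instance Definition _ := Measure.on lebesgue_rV0.

Let sigma_finite_rV0 : sigma_finite setT lebesgue_rV0.
Proof.
apply: fin_num_fun_sigma_finite; first by rewrite measure0.
by move=> A mA; rewrite /lebesgue_rV0 diracE.
Qed.

HB.instance Definition _ :=
  Measure_isSigmaFinite.Build _ _ _ lebesgue_rV0 sigma_finite_rV0.

End lebesgue_rV0.

(* n-fold product of the one-dimensional Lebesgue measure *)
Fixpoint borel_lebesgue (R : realType) (n : nat) :
    {sigma_finite_measure set 'rV[R]_n -> \bar R} :=
  match n with
  | 0 => @lebesgue_rV0 R
  | m.+1 => lebesgue_step (borel_lebesgue R m)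
  end.

(* R^n with the Lebesgue (completed Borel) sigma-algebra *)
Definition lebesgue_space (R : realType) (n : nat) :=
  caratheodory_type (borel_lebesgue R n)^*%mu.

HB.instance Definition _ (R : realType) (n : nat) :=
  Measurable.on (lebesgue_space R n).

Definition lebesgue_rV (R : realType) (n : nat) :
    set (lebesgue_space R n) -> \bar R :=
  @completed_measure_extension _ _ _ (borel_lebesgue R n).

HB.instance Definition _ (R : realType) (n : nat) :=
  Measure.on (@lebesgue_rV R n).

Lemma lebesgue_rV_complete (R : realType) (n : nat) :
  measure_is_complete (@lebesgue_rV R n).
Proof. exact: measure_is_complete_caratheodory. Qed.

Lemma lebesgue_rV_borel (R : realType) (n : nat) (A : set 'rV[R]_n) :
  measurable A -> lebesgue_rV A = borel_lebesgue R n A.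
Proof. by move=> mA; exact: measurable_mu_extE. Qed.

Lemma borel_lebesgueX (R : realType) (n : nat)
    (B : 'I_n -> set (measurableTypeR R)) :
  (forall i, measurable (B i)) ->
  borel_lebesgue R n [set x | forall i, B i (x ord0 i)] =
  (\big[*%E/1]_(i < n) lebesgue_measure (B i))%E.
Proof.
elim: n B => [|n IH] B mB.
  by rewrite big_ord0 /= /lebesgue_rV0 diracE mem_set// => -[].
rewrite big_ord_recl -IH//=.
have mH : measurable [set x : 'rV[R]_n | forall i, B (lift ord0 i) (x ord0 i)].
  rewrite (_ : [set x | _] =
      \bigcap_(i in [set: 'I_n])
        [set x : 'rV[R]_n | B (lift ord0 i) (x ord0 i)]).
    apply: fin_bigcap_measurable; first exact: finite_finset.
    move=> i _.
    rewrite -[X in measurable X]setTI.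
    by apply: (@measurable_coord R n i) => //; exact: mB.
  by apply/seteqP; split => x /= H => [i _|i]; exact: H.
rewrite -product_measure1E// /lebesgue_step /pushforward; congr (_ _).
apply/seteqP; split => [p /= H|p [/= p1 p2] i].
  split => [|i]; first by have := H ord0; rewrite rV_cons0.
  by have := H (lift ord0 i); rewrite rV_consS.
by case: (unliftP ord0 i) => [j|] ->; rewrite ?rV_consS ?rV_cons0//.
Qed.

Section domains.
Context (R : realType).

Definition boundary (T : topologicalType) (A : set T) : set T :=
  closure A `\` interior A.

Definition path_connected (T : topologicalType) (A : set T) :=
  forall x y, A x -> A y -> exists g : R -> T,
    [/\ {within `[0, 1]%classic, continuous g},
        g @` `[0, 1]%classic `<=` A, g 0 = x & g 1 = y].

(* [h (s, t)]: [s] is the parameter of the homotopy, [t] that of the loop *)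
Definition simply_connected (T : topologicalType) (A : set T) :=
  path_connected A /\
  forall g : R -> T, {within `[0, 1]%classic, continuous g} ->
    g @` `[0, 1]%classic `<=` A -> g 0 = g 1 ->
    exists h : R * R -> T,
      [/\ {within `[0, 1]%classic `*` `[0, 1]%classic, continuous h},
          h @` (`[0, 1]%classic `*` `[0, 1]%classic) `<=` A,
          (forall t, `[0, 1]%classic t -> h (0, t) = g t /\ h (1, t) = g 0) &
          (forall s, `[0, 1]%classic s -> h (s, 0) = g 0 /\ h (s, 1) = g 0)].

Definition affinely_independent (I : finType) d (p : I -> 'rV[R]_d)
    (S : {set I}) :=
  forall a : I -> R, \sum_(i in S) a i = 0 -> \sum_(i in S) a i *: p i = 0 ->
    forall i, i \in S -> a i = 0.

Definition hull (I : finType) d (p : I -> 'rV[R]_d) (S : {set I}) :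
    set 'rV[R]_d :=
  [set x | exists a : I -> R, [/\ forall i, i \in S -> 0 <= a i,
    \sum_(i in S) a i = 1 & x = \sum_(i in S) a i *: p i]].

(* bounded, with boundary a finite union of nondegenerate (d-1)-simplices *)
Definition polyhedral d (Omega : set 'rV[R]_d) :=
  bounded_set Omega /\
  exists (m : nat) (q : 'I_m -> 'rV[R]_d) (F : {set {set 'I_m}}),
    (forall S, S \in F -> #|S| = d /\ affinely_independent q S) /\
    boundary Omega = \bigcup_(S in [set` F]) hull q S.

Definition is_domain d (Omega : set 'rV[R]_d) :=
  [/\ open Omega, Omega !=set0 & connected Omega].

End domains.

(* Vertices are indexed by ['I_(nvi + nvb)], the [nvi] interior ones first; an
   element is the set of the indices of its vertices. *)
Record simplicial_mesh (R : realType) (d : nat) (Omega : set 'rV[R]_d) :=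
  SimplicialMesh {
    nvi : nat;
    nvb : nat;
    vertex : 'I_(nvi + nvb) -> 'rV[R]_d;
    elements : {set {set 'I_(nvi + nvb)}};
    vertex_inj : injective vertex;
    interior_vertex : forall j : 'I_nvi,
      ~ boundary Omega (vertex (lshift nvb j));
    boundary_vertex : forall k : 'I_nvb,
      boundary Omega (vertex (rshift nvi k));
    vertex_in_element : forall i, exists2 K, K \in elements & i \in K;
    element_card : forall K, K \in elements -> #|K| = d.+1;
    element_nondegenerate : forall K, K \in elements ->
      affinely_independent vertex K;
    conforming : forall K L, K \in elements -> L \in elements ->
      hull vertex K `&` hull vertex L = hull vertex (K :&: L);
    mesh_cover : closure Omega = \bigcup_(K in [set` elements]) hull vertex K
  }.

Arguments vertex {R d Omega} s.

Section stiffness.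
Context (R : realType) (d : nat) (Omega : set 'rV[R]_d).
Variable T : simplicial_mesh Omega.
Implicit Types (D : 'rV[R]_d -> 'M[R]_d).

Definition is_hat (i : 'I_(nvi T + nvb T)) (phi : 'rV[R]_d -> R) :=
  [/\ {within closure Omega, continuous phi},
      (forall K, K \in elements T -> exists (g : 'cV[R]_d) (c : R),
        forall x, hull (vertex T) K x -> phi x = (x *m g) 0 0 + c) &
      (forall k, phi (vertex T k) = (k == i)%:R)].

Definition grad (f : 'rV[R]_d -> R) (x : 'rV[R]_d) : 'rV[R]_d :=
  \row_i 'D_(delta_mx 0 i) f x.

(* the constant value of the gradient of [f] inside [E] *)
Definition grad_on (f : 'rV[R]_d -> R) (E : set 'rV[R]_d) : 'rV[R]_d :=
  xget 0 [set g | forall x, interior E x -> grad f x = g].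

Definition volume (E : set 'rV[R]_d) : R := fine (lebesgue_rV E).

Definition mean_mx D (E : set 'rV[R]_d) : 'M[R]_d :=
  \matrix_(i, j) ((volume E)^-1 *
    Rintegral (@lebesgue_rV R d) E (fun x => D x i j)).

Definition stiffness D (phi : 'I_(nvi T) -> 'rV[R]_d -> R) : 'M[R]_(nvi T) :=
  \matrix_(i, j) \sum_(K in elements T)
    let E := hull (vertex T) K in
    volume E * (grad_on (phi i) E *m mean_mx D E *m (grad_on (phi j) E)^T) 0 0.

End stiffness.

Arguments is_hat {R d Omega} T i phi.
Arguments stiffness {R d Omega} T D phi.

Section matrices.
Context (R : realType) (n : nat).
Implicit Types M : 'M[R]_n.

Definition possemidef M := M^T = M /\ forall v : 'rV[R]_n,
  0 <= (v *m M *m v^T) 0 0.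

Definition posdef M := M^T = M /\ forall v : 'rV[R]_n,
  v != 0 -> 0 < (v *m M *m v^T) 0 0.

Definition largest_eigenvalue M (lam : R) :=
  eigenvalue M lam /\ forall mu, eigenvalue M mu -> mu <= lam.

End matrices.

(* Main.v *)
Require Import Defs.
From HB Require Import structures.
From mathcomp Require Import all_boot all_order all_algebra.
From mathcomp Require Import all_classical all_reals all_analysis.
From mathcomp Require Import measurable_realfun ring lra.
Import Order.TTheory GRing.Theory Num.Theory.
Import numFieldNormedType.Exports.

Local Open Scope classical_set_scope.
Local Open Scope ring_scope.

(** The stiffness matrix is a sum over the elements [K] of positive semidefinite
    local matrices [A_K] whose nonzero entries involve only the [d + 1] vertices
    of [K].  As [2 v_i v_j (A_K)_ij <= v_i^2 (A_K)_ii + v_j^2 (A_K)_jj], each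
    satisfies [v A_K v^T <= (d + 1) \sum_i v_i^2 (A_K)_ii]; summing over [K] gives
    the same bound for [A], hence both upper bounds.  The lower bounds are
    Rayleigh quotients at coordinate vectors.

    The diffusion matrix is controlled only on the open set [Omega], so the mean
    over a closed element requires [boundary Omega] to be Lebesgue-null: it lies
    in finitely many hyperplanes.  Positivity of [A_jj], without which the
    preconditioner would be singular, uses ellipticity, the nonempty interior of
    an element and the nonvanishing gradient of the hat function there. *)

(** * Quadratic forms and the largest eigenvalue of a symmetric matrix *)

Definition qform {R : realType} {n} (A : 'M[R]_n) (v : 'rV[R]_n) : R :=
  (v *m A *m v^T) 0 0.

Lemma qformE {R : realType} {n} (A : 'M[R]_n) (v : 'rV[R]_n) :
  qform A v = \sum_i \sum_j v 0 i * v 0 j * A i j.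
Proof.
rewrite /qform mxE exchange_big/=; apply: eq_bigr => j _.
rewrite !mxE mulr_suml; apply: eq_bigr => i _; ring.
Qed.

Lemma sqnormE {R : realType} {n} (v : 'rV[R]_n) :
  (v *m v^T) 0 0 = \sum_i v 0 i ^+ 2.
Proof. by rewrite mxE; apply: eq_bigr => i _; rewrite mxE. Qed.

Lemma sqnorm_ge0 {R : realType} {n} (v : 'rV[R]_n) : 0 <= (v *m v^T) 0 0.
Proof. by rewrite sqnormE sumr_ge0// => i _; rewrite sqr_ge0. Qed.

Lemma sqnorm_eq0 {R : realType} {n} (v : 'rV[R]_n) :
  ((v *m v^T) 0 0 == 0) = (v == 0).
Proof.
rewrite sqnormE psumr_eq0; last by move=> i _; rewrite sqr_ge0.
apply/allP/eqP => [v0|-> i _ /=]; last by rewrite mxE expr0n eqxx.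
apply/rowP => i; rewrite mxE; apply/eqP.
by have := v0 i (mem_index_enum i); rewrite /= sqrf_eq0.
Qed.

Lemma sqnorm_gt0 {R : realType} {n} (v : 'rV[R]_n) :
  v != 0 -> 0 < (v *m v^T) 0 0.
Proof. by move=> v0; rewrite lt_def sqnorm_eq0 v0 sqnorm_ge0. Qed.

Lemma bilin_sym {R : realType} {n} (A : 'M[R]_n) (u v : 'rV[R]_n) :
  A^T = A -> (u *m A *m v^T) 0 0 = (v *m A *m u^T) 0 0.
Proof.
move=> As; have <- : (v *m A *m u^T)^T 0 0 = (v *m A *m u^T) 0 0 by rewrite mxE.
by rewrite !trmx_mul trmxK As mulmxA.
Qed.

Lemma qformD {R : realType} {n} (A : 'M[R]_n) (u v : 'rV[R]_n) t :
  A^T = A -> qform A (u + t *: v) =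
  qform A u + t * (2 * (u *m A *m v^T) 0 0) + t ^+ 2 * qform A v.
Proof.
move=> As; rewrite /qform linearD/= linearZ/= !(mulmxDl, mulmxDr).
rewrite -!(scalemxAl, scalemxAr).
have E := bilin_sym A v u As.
have addE (M N : 'M[R]_1) : (M + N) 0 0 = M 0 0 + N 0 0 by rewrite mxE.
have scaleE a (M : 'M[R]_1) : (a *: M) 0 0 = a * M 0 0 by rewrite mxE.
rewrite !(addE, scaleE) E; ring.
Qed.

(** With [w = v *m M], the form at [v + t *: w] is a quadratic in [t] with constant term 0 and
    linear coefficient [2 |w|^2]; it is nonnegative for all [t] only if [w = 0]. *)
Lemma psd_kernel {R : realType} {n} (M : 'M[R]_n) (v : 'rV[R]_n) :
  possemidef M -> qform M v = 0 -> v *m M = 0.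
Proof.
move=> [Ms M0] qv; apply/eqP; rewrite -sqnorm_eq0; apply/eqP.
pose w := v *m M; pose b : R := (w *m w^T) 0 0; rewrite -[LHS]/b.
have q t : 0 <= t * (2 * b) + t ^+ 2 * qform M w.
  by have := M0 (v + t *: w); rewrite -/(qform _ _) qformD// qv add0r.
have b0 : 0 <= b := sqnorm_ge0 w.
have c0 : 0 <= qform M w := M0 w.
set c := qform M w in q c0.
apply/eqP; rewrite eq_le b0 andbT leNgt; apply/negP => bp.
have c1 : 0 < c + 1 by lra.
(* The minimiser would be [- b / c]; taking [c + 1] instead covers [c = 0] and still gives a
   negative value. *)
have := q (- (b / (c + 1))).
have -> : - (b / (c + 1)) * (2 * b) + (- (b / (c + 1))) ^+ 2 * c =
  - (b ^+ 2 * (c + 2)) / (c + 1) ^+ 2 by field; rewrite gt_eqF.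
rewrite pmulr_lge0 ?invr_gt0 ?exprn_gt0// oppr_ge0 leNgt mulr_gt0//.
  exact: exprn_gt0.
by lra.
Qed.

Lemma continuous_qform {R : realType} {n} (A : 'M[R]_n) :
  continuous (qform A).
Proof.
rewrite (_ : qform A = fun v => \sum_i \sum_j v 0 i * v 0 j * A i j); last first.
  by apply/funext => v; exact: qformE.
apply: continuous_big => [|i _]; first exact: add_continuous.
apply: continuous_big => [|j _]; first exact: add_continuous.
move=> v; apply: (@cvgM _ _ (nbhs v)); last exact: cvg_cst.
by apply: (@cvgM _ _ (nbhs v)); exact: coord_continuous.
Qed.

(* The maximum [lam] of the Rayleigh quotient makes [lam%:M - A] positive
   semidefinite with a null direction, which is then an eigenvector. *)
Lemma symmetric_largest_eigenvalue {R : realType} {n} (A : 'M[R]_n)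
    (j0 : 'I_n) : A^T = A ->
  exists2 lam, largest_eigenvalue A lam &
    forall v, qform A v <= lam * (v *m v^T) 0 0.
Proof.
move=> As; pose S := [set v : 'rV[R]_n | qform 1%:M v = 1].
have SE v : qform 1%:M v = (v *m v^T) 0 0 by rewrite /qform mulmx1.
have S0 : S !=set0.
  exists (delta_mx 0 j0); rewrite /S/= SE sqnormE (bigD1 j0)//= big1 ?addr0.
    by rewrite mxE !eqxx expr1n.
  by move=> i ij; rewrite mxE (negbTE ij) andbF expr0n.
have cS : compact S.
  apply: bounded_closed_compact.
    exists 1; split => // x x1 v /=; rewrite /S/= SE sqnormE => v1.
    apply: (le_trans _ (ltW x1)).
    rewrite /Num.norm/= mx_normrE; apply/bigmax_leP; split => //= -[i j] _ /=.
    rewrite ord1 -(@ler_pXn2r _ 2)// ?nnegrE// expr1n -normrX ger0_norm ?sqr_ge0//.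
    rewrite -v1 (bigD1 j)//= lerDl sumr_ge0// => k _; exact: sqr_ge0.
  have -> : S = qform 1%:M @^-1` [set 1] by [].
  apply: preimage_closed; last exact: (@closed_eq R 1).
  by move=> v _; exact: continuous_qform.
have [c cin cmax] := @EVT_max_rV R n (qform A) S S0 cS
  (continuous_subspaceT (@continuous_qform R n A)).
rewrite inE/= in cin; move: cin; rewrite /S/= SE => c1.
set lam := qform A c in cmax.
have ub v : qform A v <= lam * (v *m v^T) 0 0.
  have [->|v0] := eqVneq v 0.
    by rewrite /qform !mul0mx mxE mulr0.
  have vp := sqnorm_gt0 _ v0.
  set s := (v *m v^T) 0 0 in vp *.
  have := cmax ((Num.sqrt s)^-1 *: v).
  have qZ (M : 'M[R]_n) : qform M ((Num.sqrt s)^-1 *: v) = s^-1 * qform M v.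
    rewrite /qform linearZ/= -!scalemxAl -scalemxAr !mxE mulrA.
    by rewrite -expr2 exprVn sqr_sqrtr// ltW.
  rewrite qZ inE/= /S/= qZ SE -/s mulVf ?gt_eqF// => /(_ erefl).
  by rewrite mulrC ler_pdivrMr.
have psd : possemidef (lam%:M - A).
  split; first by rewrite linearB/= tr_scalar_mx As.
  move=> v; rewrite mulmxBr mulmxBl mul_mx_scalar -scalemxAl.
  by rewrite mxE [X in X + _]mxE [X in _ + X]mxE subr_ge0 ub.
exists lam => //; split.
  apply/eigenvalueP; exists c; last first.
    by apply/eqP => c0; move: c1; rewrite c0 mul0mx mxE => /eqP; rewrite eq_sym oner_eq0.
  have := psd_kernel (lam%:M - A) c psd.
  rewrite {1}/qform mulmxBr mulmxBl mul_mx_scalar -scalemxAl.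
  rewrite mxE [X in X + _]mxE [X in _ + X]mxE c1 mulr1 subrr => /(_ erefl).
  by move/subr0_eq.
move=> mu /eigenvalueP[v vA v0].
have := ub v; rewrite /qform vA -scalemxAl mxE ler_pM2r//.
exact: sqnorm_gt0.
Qed.

(** The diagonal entries are Rayleigh quotients at coordinate vectors; the upper bound evaluates the
    hypothesis at an eigenvector. The index [j0] ensures [n > 0], so that eigenvalues exist. *)
Lemma largest_eigenvalue_bounds {R : realType} {n} (A : 'M[R]_n)
    (j0 : 'I_n) (c : R) : A^T = A ->
  (forall v, qform A v <= c * (v *m v^T) 0 0) ->
  exists2 lam, largest_eigenvalue A lam &
    (forall j, A j j <= lam) /\ lam <= c.
Proof.
move=> As Ac; have [lam [evl lmax] ub] := symmetric_largest_eigenvalue A j0 As.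
exists lam; [by []|split].
  move=> j; have := ub (delta_mx 0 j).
  rewrite /qform -rowE trmx_delta -colE !mxE.
  rewrite (bigD1 j)//= big1 ?addr0 => [|i ij].
    by rewrite !mxE !eqxx !mulr1.
  by rewrite !mxE (negbTE ij) mulr0.
have /eigenvalueP[v vA v0] := evl.
have := Ac v; rewrite /qform vA -scalemxAl mxE ler_pM2r//.
exact: sqnorm_gt0.
Qed.

(** * Affine functions, barycentric coordinates and simplices *)

Definition affine {R : realType} {d} (u : 'cV[R]_d * R) (x : 'rV[R]_d) : R :=
  (x *m u.1) 0 0 + u.2.

Lemma affineE {R : realType} {d} (u : 'cV[R]_d * R) x :
  affine u x = \sum_j x 0 j * u.1 j 0 + u.2.
Proof. by rewrite /affine mxE. Qed.

Lemma affine_sum {R : realType} {d} (u : 'cV[R]_d * R) (I : finType)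
    (K : {set I}) (a : I -> R) (p : I -> 'rV[R]_d) :
  \sum_(i in K) a i = 1 ->
  affine u (\sum_(i in K) a i *: p i) = \sum_(i in K) a i * affine u (p i).
Proof.
move=> a1; rewrite /affine mulmx_suml summxE.
rewrite -[X in _ + X]mul1r -a1 mulr_suml -big_split/=; apply: eq_bigr => i _.
by rewrite -scalemxAl mxE mulrDr.
Qed.

Lemma continuous_affine {R : realType} {d} (u : 'cV[R]_d * R) :
  continuous (affine u).
Proof.
rewrite (_ : affine u = fun x => \sum_j x 0 j * u.1 j 0 + u.2); last first.
  by apply/funext => x; rewrite affineE.
move=> x; apply: (@cvgD _ _ _ (nbhs x)); last exact: cvg_cst.
apply: cvg_big => [|j _]; first exact: add_continuous.
apply: (@cvgM _ _ (nbhs x)); last exact: cvg_cst.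
exact: coord_continuous.
Qed.

(* The rows [(1, p i)], [i \in K], form an invertible matrix, whose inverse
   gives the barycentric coordinates. *)
Lemma barycentric_coordinates {R : realType} {d} (I : finType)
    (p : I -> 'rV[R]_d) (K : {set I}) :
  #|K| = d.+1 -> affinely_independent p K ->
  exists u : I -> 'cV[R]_d * R, forall x (a : I -> R),
    (\sum_(i in K) a i = 1 /\ x = \sum_(i in K) a i *: p i) <->
    (forall i, i \in K -> a i = affine (u i) x).
Proof.
move=> cK aK.
have [e [f [eK fe ef]]] : exists (e : 'I_(1 + d) -> I) (f : I -> 'I_(1 + d)),
    [/\ forall k, e k \in K, cancel e f & {in K, cancel f e}].
  have [i0 i0K] : exists i, i \in K by apply/card_gt0P; rewrite cK.
  exists (fun k => enum_val (cast_ord (esym cK) k)).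
  exists (fun i => cast_ord cK (enum_rank_in i0K i)); split.
  - by move=> k; exact: enum_valP.
  - by move=> k; rewrite enum_valK_in cast_ordKV.
  - by move=> i iK; rewrite cast_ordK enum_rankK_in.
have sumK (V : nmodType) (F : I -> V) : \sum_(i in K) F i = \sum_k F (e k).
  rewrite (reindex e); last by exists f => // k _.
  by apply: eq_bigl => k; rewrite eK.
pose P : 'M[R]_(1 + d) := \matrix_k row_mx (const_mx 1 : 'rV_1) (p (e k)).
have mulP (v : 'rV_(1 + d)) :
    v *m P = row_mx (const_mx (\sum_k v 0 k)) (\sum_k v 0 k *: p (e k)).
  rewrite mulmx_sum_row; under eq_bigr do rewrite rowK.
  rewrite -[RHS]hsubmxK -[LHS]hsubmxK; congr row_mx.
    rewrite row_mxKl; apply/rowP => j; rewrite !mxE summxE; apply: eq_bigr => k _.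
    by rewrite mxE row_mxEl mxE mulr1.
  rewrite row_mxKr; apply/rowP => j; rewrite !mxE !summxE; apply: eq_bigr => k _.
  by rewrite mxE row_mxEr mxE.
(* A left kernel vector gives coefficients with zero sum and zero combination of the vertices, which
   affine independence excludes. *)
have uP : P \in unitmx.
  rewrite -row_free_unit -kermx_eq0; apply/rowV0P => v /sub_kermxP vP0.
  have : v *m P = row_mx (0 : 'rV_1) (0 : 'rV_d) by rewrite row_mx0.
  rewrite mulP => /eq_row_mx[v1 v2].
  apply/rowP => k; rewrite mxE -(fe k).
  apply: (aK (fun i => v 0 (f i))) => //.
  - rewrite sumK; under eq_bigr do rewrite fe.
    by move: v1 => /rowP/(_ 0); rewrite !mxE.
  - by rewrite sumK; under eq_bigr do rewrite fe.
pose B := invmx P.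
(* Column [f i] of the inverse holds the constant term of the coordinate function of [i] in its
   first row and the linear part below. *)
exists (fun i => (\col_j B (rshift 1 j) (f i), B (lshift d 0) (f i))) => x a.
have aff i : affine (\col_j B (rshift 1 j) (f i), B (lshift d 0) (f i)) x =
    (row_mx (const_mx 1 : 'rV_1) x *m B) 0 (f i).
  rewrite affineE/= mxE big_split_ord/= big_ord1 row_mxEl mxE mul1r addrC.
  by congr +%R; apply: eq_bigr => j _; rewrite row_mxEr mxE.
rewrite !sumK; pose v : 'rV_(1 + d) := \row_k a (e k).
have vP : v *m P = row_mx (const_mx (\sum_k a (e k))) (\sum_k a (e k) *: p (e k)).
  by rewrite mulP; congr (row_mx (const_mx _) _); apply: eq_bigr => k _; rewrite mxE.
split=> [[a1 xE] i iK|aE].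
  rewrite aff -a1 xE -vP mulmxK// mxE; congr a; exact/esym/ef.
have vE : v = row_mx (const_mx 1 : 'rV_1) x *m B.
  by apply/rowP => k; rewrite mxE aE// aff fe.
have : v *m P = row_mx (const_mx 1 : 'rV_1) x by rewrite vE mulmxKV.
by rewrite vP => /eq_row_mx[/rowP/(_ 0)]; rewrite !mxE.
Qed.

Lemma hull_halfspaces {R : realType} {d} (I : finType)
    (p : I -> 'rV[R]_d) (K : {set I}) :
  #|K| = d.+1 -> affinely_independent p K ->
  exists u : I -> 'cV[R]_d * R,
    hull p K = [set x | forall i, i \in K -> 0 <= affine (u i) x] /\
    (interior (hull p K)) !=set0.
Proof.
move=> cK aK; have [u uP] := barycentric_coordinates I p K cK aK; exists u.
have hullE : hull p K = [set x | forall i, i \in K -> 0 <= affine (u i) x].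
  apply/seteqP; split=> x /= => [[a [a0 a1 xE]] i iK|x0].
    by rewrite -((uP x a).1 (conj a1 xE)) ?a0.
  exists (fun i => affine (u i) x).
  by have [|? ?] := (uP x (fun i => affine (u i) x)).2; [|split].
(* At the centroid all barycentric coordinates equal [1 / (d + 1)]; by continuity they stay positive
   nearby. *)
split => //; pose z := \sum_(i in K) (d.+1%:R : R)^-1 *: p i.
have zE i : i \in K -> affine (u i) z = d.+1%:R^-1.
  move=> iK; symmetry; apply: (uP z (fun=> d.+1%:R^-1)).1 => //; split => //.
  by rewrite sumr_const cK -[LHS]mulr_natr mulVf// pnatr_eq0.
exists z; rewrite /interior/= hullE.
have : \forall x \near z, forall i, i \in K -> 0 < affine (u i) x.
  apply: (@filter_forall _ _ _ (nbhs z) _) => i.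
  have [iK|iK] := boolP (i \in K); last exact: nearW.
  have : 0 < affine (u i) z by rewrite zE// invr_gt0 ltr0n.
  move=> /(cvgr_gt _ (continuous_affine (u i) z)); exact: filterS.
by apply: filterS => x /= H i /H/ltW.
Qed.

(** * Lebesgue measure of simplices, hyperplanes and the domain *)

Lemma measurable_affine {R : realType} {d} (u : 'cV[R]_d * R) :
  measurable_fun [set: 'rV[R]_d] (affine u).
Proof.
rewrite (_ : affine u = fun x => \sum_j x 0 j * u.1 j 0 + u.2); last first.
  by apply/funext => x; rewrite affineE.
apply: measurable_funD => //; apply: measurable_sum => j.
by apply: measurable_funM => //; exact: measurable_coord.
Qed.

Lemma measurable_hull {R : realType} {d} (I : finType)
    (p : I -> 'rV[R]_d) (K : {set I}) :
  #|K| = d.+1 -> affinely_independent p K -> measurable (hull p K).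
Proof.
move=> cK aK; have [u [-> _]] := hull_halfspaces I p K cK aK.
rewrite (_ : [set x | _] = \bigcap_(i in [set` K]) (affine (u i) @^-1` `[0, +oo[)).
  apply: fin_bigcap_measurable; first exact: finite_finset.
  move=> i _; rewrite -[X in measurable X]setTI.
  exact: measurable_affine.
apply/seteqP; split => x /= H i /= iK; first by rewrite in_itv/= H.
by have := H i iK; rewrite /= in_itv/= andbT.
Qed.

Lemma lebesgue_measurable {R : realType} {d} (A : set 'rV[R]_d) :
  measurable A -> measurable (A : set (lebesgue_space R d)).
Proof. exact: caratheodory_measurable_mu_ext. Qed.

(** Induction on the dimension: fixing the first coordinate leaves in general a hyperplane of one
    dimension less, which is null, and the product measure integrates these slices. *)
Lemma hyperplane_null {R : realType} {d} (u : 'cV[R]_d * R) :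
  u.1 != 0 -> borel_lebesgue R d [set x | affine u x = 0] = 0%E.
Proof.
elim: d u => [|d IH] [g c] /=; first by rewrite [g]flatmx0 eqxx.
move=> g0; pose g' : 'cV_d := \col_i g (lift ord0 i) 0.
have affS p : affine (g, c) (rV_cons p) = affine (g', p.1 * g 0 0 + c) p.2.
  rewrite !affineE/= big_ord_recl rV_cons0 -addrA addrCA; congr (_ + _).
  by apply: eq_bigr => i _; rewrite rV_consS mxE.
(* If the normal is parallel to the first axis, the slices are empty or full; the hyperplane is then
   a box whose first side is a single point. *)
have [g'0|g'0] := eqVneq g' 0.
  have g00 : g 0 0 != 0.
    apply: contraNneq g0 => g00; apply/eqP/colP => i; rewrite mxE.
    case: (unliftP ord0 i) => [j|] -> //.
    by move/colP: g'0 => /(_ j); rewrite !mxE.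
  pose B (i : 'I_d.+1) : set (measurableTypeR R) :=
    if i == 0 then [set - c / g 0 0] else setT.
  rewrite (_ : [set x | affine (g, c) x = 0] =
      [set x | forall i, B i (x ord0 i)]).
    have mB i : measurable (B i) by rewrite /B; case: ifP.
    apply: (etrans (borel_lebesgueX mB)).
    by rewrite big_ord_recl/= lebesgue_measure_set1 mul0e.
  apply/seteqP; split => x /=.
    rewrite affineE/= big_ord_recl big1 => [|i _]; last first.
      by move/colP: g'0 => /(_ i); rewrite !mxE => ->; rewrite mulr0.
    rewrite addr0 => /eqP; rewrite addr_eq0 => /eqP xE i; rewrite /B; case: eqP => // ->/=.
    by rewrite -xE mulfK.
  move=> /(_ 0); rewrite /B eqxx/= => x0; rewrite affineE/= big_ord_recl big1 => [|i _]; last first.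
    by move/colP: g'0 => /(_ i); rewrite !mxE => ->; rewrite mulr0.
  by rewrite x0 divfK// addr0 addNr.
rewrite /lebesgue_step /pushforward /product_measure1.
under eq_integral => x _.
  rewrite (_ : (_ \o _) x = 0%E); first over.
  rewrite /= -(IH (g', x * g 0 0 + c) g'0); congr (borel_lebesgue R d _).
  by apply/seteqP; split => y; rewrite /xsection/= inE/= affS.
exact: integral0.
Qed.

Lemma measurable_box {R : realType} {d} (B : 'I_d -> set (measurableTypeR R)) :
  (forall i, measurable (B i)) ->
  measurable [set x : 'rV[R]_d | forall i, B i (x ord0 i)].
Proof.
move=> mB; rewrite (_ : [set x | _] = \bigcap_(i in [set: 'I_d])
    ((fun x : 'rV[R]_d => x ord0 i) @^-1` B i)).
  apply: fin_bigcap_measurable; first exact: finite_finset.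
  move=> i _; rewrite -[X in measurable X]setTI.
  by apply: (@measurable_coord R d i) => //; exact: mB.
by apply/seteqP; split => x /= H i; [move=> _|]; exact: H.
Qed.

Lemma hull_bounded {R : realType} {d} (I : finType) (p : I -> 'rV[R]_d)
    (K : {set I}) :
  exists M, forall x j, hull p K x -> `|x 0 j| <= M.
Proof.
exists (\sum_i \sum_j `|p i 0 j|) => x j [a [a0 a1 ->]].
rewrite summxE (le_trans (ler_norm_sum _ _ _))//.
rewrite -[leRHS]mul1r -a1 mulr_suml ler_sum// => i iK.
rewrite mxE normrM ger0_norm ?a0// ler_wpM2l ?a0//.
rewrite (bigD1 i)//= (bigD1 j)//= -addrA lerDl addr_ge0// ?sumr_ge0// => k _.
by rewrite sumr_ge0.
Qed.

Lemma hull_lebesgue_lty {R : realType} {d} (I : finType) (p : I -> 'rV[R]_d)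
    (K : {set I}) :
  #|K| = d.+1 -> affinely_independent p K ->
  (@lebesgue_rV R d (hull p K) < +oo)%E.
Proof.
move=> cK aK; have mK := measurable_hull I p K cK aK.
have [M xM] := hull_bounded I p K.
rewrite lebesgue_rV_borel//.
pose B (i : 'I_d) : set (measurableTypeR R) := `[- M, M]%classic.
have mB i : measurable (B i) by exact: measurable_itv.
apply: (@le_lt_trans _ _ (borel_lebesgue R d
  [set x | forall i : 'I_d, B i (x ord0 i)])).
  apply: le_measure; rewrite ?inE//; first exact: measurable_box.
  by move=> x Kx i; rewrite /B/= in_itv/= -ler_norml xM.
rewrite (borel_lebesgueX mB).
suff [] : ((0 : \bar R) <= \big[*%E/1]_(i < d) lebesgue_measure (B i) /\
    \big[*%E/1]_(i < d) lebesgue_measure (B i) < +oo)%E by [].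
elim/big_ind : _ => [|x y [x0 xoo] [y0 yoo]|i _]; first by rewrite lee01 ltry.
  by rewrite mule_ge0// lte_mul_pinfty// ge0_fin_numE.
rewrite measure_ge0 lebesgue_measure_itv/=.
by case: ifP => _; rewrite ?ltry// -EFinB ltry.
Qed.

(** Balls of row vectors are cubes in the max norm, and a cube has the product of its positive side
    lengths as measure. *)
Lemma interior_lebesgue_gt0 {R : realType} {d} (A : set 'rV[R]_d) :
  measurable A -> interior A !=set0 -> (0 < @lebesgue_rV R d A)%E.
Proof.
move=> mA [z /nbhs_ballP[e /= e0 zeA]]; rewrite lebesgue_rV_borel//.
pose B (i : 'I_d) : set (measurableTypeR R) :=
  `]z ord0 i - e, z ord0 i + e[%classic.
have mB i : measurable (B i) by exact: measurable_itv.
apply: (@lt_le_trans _ _ (borel_lebesgue R d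
  [set x | forall i : 'I_d, B i (x ord0 i)])).
  rewrite (borel_lebesgueX mB); elim/big_ind : _ => //.
    by move=> x y x0 y0; exact: mule_gt0.
  move=> i _; rewrite lebesgue_measure_itv/= lte_fin ltrD2l gtrN//.
  by rewrite -EFinB lte_fin subr_gt0 ltrD2l gtrN.
apply: le_measure; rewrite ?inE//; first exact: measurable_box.
move=> x /= xB; apply: zeA; split => // i j; rewrite ord1.
by have := xB j; rewrite /B/= in_itv/= /ball/= distrC ltr_distl.
Qed.

(** The matrix with rows [(p i, 1)] has [d] rows and [d + 1] columns, so some nonzero affine
    function vanishes at all the points, hence on their hull. *)
Lemma hull_sub_hyperplane {R : realType} {d} (I : finType)
    (p : I -> 'rV[R]_d) (S : {set I}) : (1 <= d)%N -> #|S| = d ->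
  exists2 u : 'cV[R]_d * R, u.1 != 0 & hull p S `<=` [set x | affine u x = 0].
Proof.
move=> d1 cS.
pose P : 'M[R]_(#|S|, d + 1) :=
  \matrix_k row_mx (p (enum_val k)) (const_mx 1 : 'rV_1).
have : kermx P^T != 0.
  rewrite -mxrank_eq0 mxrank_ker mxrank_tr -lt0n subn_gt0.
  by rewrite (leq_ltn_trans (rank_leq_row _))// cS addn1.
move=> /rowV0Pn[w /sub_kermxP wP w0].
pose u := ((lsubmx w)^T, w 0 (rshift d 0)).
have u0 i : i \in S -> affine u (p i) = 0.
  move=> iS; rewrite affineE/=.
  move/rowP: wP => /(_ (enum_rank_in iS i)); rewrite !mxE => E; apply: (etrans _ E).
  rewrite big_split_ord/= big_ord1; congr +%R.
    apply: eq_bigr => j _; rewrite [P^T _ _]mxE [P _ _]mxE row_mxEl.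
    by rewrite enum_rankK_in// mulrC mxE mxE.
  by rewrite [P^T _ _]mxE [P _ _]mxE row_mxEr mxE mulr1.
exists u; last first.
  move=> x [a [_ a1 ->]] /=; rewrite affine_sum// big1// => i iS.
  by rewrite u0// mulr0.
(* Were the linear part zero, the value at one of the points would make the constant vanish too;
   [1 <= d] provides a point. *)
apply: contra_neq w0 => /= u10; rewrite -[w]hsubmxK.
have -> : lsubmx w = 0 by rewrite -[lsubmx w]trmxK u10 trmx0.
have [i iS] : exists i, i \in S by apply/card_gt0P; rewrite cS.
have := u0 i iS; rewrite affineE /u/= u10 big1 => [|j _]; last first.
  by rewrite mxE mulr0.
rewrite add0r => w1; rewrite (_ : rsubmx w = 0) ?row_mx0//.
by apply/rowP => j; rewrite !mxE ord1.
Qed.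

Lemma polyhedral_boundary_negligible {R : realType} {d} (Omega : set 'rV[R]_d) :
  (1 <= d)%N -> polyhedral Omega ->
  (@lebesgue_rV R d).-negligible (boundary Omega).
Proof.
move=> d1 [_ [m [q [F [FS ->]]]]].
rewrite (_ : [set` F] = [set` enum F]); last first.
  by apply/seteqP; split => S /=; rewrite mem_enum.
rewrite bigcup_seq big_seq; elim/big_ind : _ => [|A B|S].
- exact: negligible_set0.
- exact: negligibleU.
rewrite mem_enum => /FS[cS _]; have [u u0] := hull_sub_hyperplane _ q S d1 cS.
move=> sub; exists [set x | affine u x = 0].
have mH : measurable [set x : 'rV[R]_d | affine u x = 0].
  rewrite -[X in measurable X]setTI.
  by apply: (measurable_affine u _ [set 0]).
split=> //; first exact: lebesgue_measurable.
by rewrite lebesgue_rV_borel// hyperplane_null.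
Qed.

(** [Omega] is its closure minus its boundary. The mesh makes the closure a finite union of
    simplices, and the null boundary is measurable by completeness. *)
Lemma lebesgue_measurable_domain {R : realType} {d} (Omega : set 'rV[R]_d)
    (T : simplicial_mesh Omega) :
  (1 <= d)%N -> open Omega -> polyhedral Omega ->
  measurable (Omega : set (lebesgue_space R d)).
Proof.
move=> d1 oO pO.
have nB := polyhedral_boundary_negligible _ d1 pO.
have -> : Omega = closure Omega `\` boundary Omega.
  rewrite /boundary setDD (_ : interior Omega = Omega); last exact/interior_id.
  by rewrite setIC setIidl//; exact: subset_closure.
apply: measurableD; last exact: lebesgue_rV_complete.
rewrite (mesh_cover T); apply: fin_bigcup_measurable => [|K /= KT].
  exact: finite_finset.
apply: lebesgue_measurable; apply: measurable_hull.
  exact: element_card.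
exact: element_nondegenerate.
Qed.

(** * Entrywise bounds for positive semidefinite matrices *)

Lemma qform_delta {R : realType} {n} (A : 'M[R]_n) i : qform A (delta_mx 0 i) = A i i.
Proof. by rewrite /qform -rowE trmx_delta -colE !mxE. Qed.

(** This is the nonnegativity of the form at [a e_i - b e_j], expanded. *)
Lemma psd_entry_le {R : realType} {n} (A : 'M[R]_n) i j (a b : R) :
  possemidef A -> a * b * A i j <= (a ^+ 2 * A i i + b ^+ 2 * A j j) / 2.
Proof.
move=> [As A0]; pose e k : 'rV[R]_n := delta_mx 0 k.
have := A0 (a *: e i + (- b) *: e j); rewrite -/(qform _ _) qformD//.
have -> : qform A (a *: e i) = a ^+ 2 * A i i.
  rewrite /qform linearZ/= -!scalemxAl -scalemxAr !scalerA mxE -expr2.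
  by rewrite -[X in _ * X]/(qform A (e i)) qform_delta.
have -> : (a *: e i *m A *m (e j)^T) 0 0 = a * A i j.
  by rewrite -!scalemxAl mxE -rowE trmx_delta -colE !mxE.
by rewrite qform_delta => ?; lra.
Qed.

Lemma psd_entry {R : realType} {n} (A : 'M[R]_n) i j :
  possemidef A -> `|A i j| <= (A i i + A j j) / 2.
Proof.
move=> Apsd; have := psd_entry_le A i j 1 1 Apsd.
have := psd_entry_le A i j 1 (-1) Apsd.
by rewrite ler_norml sqrrN !expr1n => q1 q2; apply/andP; split; lra.
Qed.

(** * Integrals of finite sums and integrals up to null sets *)

Section Rintegral_sum.
Context {d} {T : measurableType d} {R : realType} {mu : {measure set T -> \bar R}}.
Context {D : set T} (mD : measurable D) {I : Type} (f : I -> T -> R).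
Hypothesis intf : forall i, mu.-integrable D (EFin \o f i).

Lemma integrable_Rsum (s : seq I) :
  mu.-integrable D (EFin \o (fun x => \sum_(i <- s) f i x)).
Proof.
rewrite (_ : EFin \o _ = fun x => (\sum_(i <- s) (f i x)%:E)%E); last first.
  by apply/funext => x /=; rewrite sumEFin.
by apply: (integrable_sum mD) => i _; exact: intf.
Qed.

Lemma Rintegral_sum (s : seq I) :
  Rintegral mu D (fun x => \sum_(i <- s) f i x) =
  \sum_(i <- s) Rintegral mu D (f i).
Proof.
elim: s => [|i s IH].
  under eq_Rintegral do rewrite big_nil; rewrite big_nil.
  by rewrite /Rintegral integral0.
under eq_Rintegral do rewrite big_cons; rewrite big_cons -IH.
by rewrite RintegralD//; exact: integrable_Rsum.
Qed.

End Rintegral_sum.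

Section complete.
Context {d} {T : measurableType d} {R : realType} {mu : {measure set T -> \bar R}}.
Hypothesis mu_complete : measure_is_complete mu.
Context {E O : set T} (mE : measurable E) (mO : measurable O).
Hypothesis EO : mu.-negligible (E `\` O).

(** The part of [E] outside [O] is null, so by completeness [f] is measurable on [E] whatever its
    values there, and the integral ignores them. *)
Lemma Rintegral_conull (f : T -> R) : measurable_fun O f ->
  Rintegral mu E f = Rintegral mu (E `&` O) f.
Proof.
move=> mf; rewrite Rintegral_mkcondr /Rintegral; congr fine.
have mEf (g : T -> R) : measurable_fun (E `&` O) g -> measurable_fun E g.
  move=> mg _ Y mY.
  rewrite -(setUIDK E O) setIUl; apply: measurableU.
    by apply: mg => //; exact: measurableI.
  apply: mu_complete; apply: negligibleS EO; exact: subIsetl.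
have mf' : measurable_fun (E `&` O) f.
  by apply: measurable_funS mf => //; exact: subIsetr.
apply: ae_eq_integral => //.
- by apply/measurable_EFinP; exact: mEf.
- apply/measurable_EFinP; apply: mEf.
  apply: (eq_measurable_fun f) => // x; rewrite inE => -[_ Ox].
  by rewrite patchE mem_set.
- apply: negligibleS EO => x /= /not_implyP[Ex H]; split => // Ox.
  by apply: H; rewrite patchE mem_set.
Qed.

Lemma measure_conull : mu E = mu (E `&` O).
Proof.
rewrite (measureDI _ mE mO) (measure_negligible _ EO) ?add0e//.
exact: measurableD.
Qed.

End complete.

(** * Ellipticity of the mean diffusion matrix *)

(** The assumptions on [D] hold on [Omega] only, so integrals over [E] are replaced by integrals
    over [E'], a set of the same measure. The form of the mean is the mean of the forms, and the
    pointwise lower bound integrates. *)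
Lemma mean_mx_elliptic {R : realType} {d} (Omega E : set 'rV[R]_d)
    (D : 'rV[R]_d -> 'M[R]_d) (dmin dmax : R) :
  measurable (Omega : set (lebesgue_space R d)) ->
  measurable (E : set (lebesgue_space R d)) ->
  (0 < @lebesgue_rV R d E < +oo)%E ->
  (@lebesgue_rV R d).-negligible (E `\` Omega) ->
  (forall i j, measurable_fun (Omega : set (lebesgue_space R d))
                 (fun x : lebesgue_space R d => D x i j)) ->
  (forall x, Omega x -> posdef (D x)) ->
  (forall x, Omega x -> possemidef (D x - dmin%:M) /\
                        possemidef (dmax%:M - D x)) ->
  (mean_mx D E)^T = mean_mx D E /\
  forall v, dmin * (v *m v^T) 0 0 <= qform (mean_mx D E) v.
Proof.
move=> mO mE /andP[E0 Eoo] EO mD Dpos Db.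
set mu := @lebesgue_rV R d in E0 Eoo EO *.
pose E' : set (lebesgue_space R d) := E `&` Omega.
have mE' : measurable E' by exact: measurableI.
have cmu : measure_is_complete mu by exact: lebesgue_rV_complete.
have muE : mu E = mu E' := measure_conull mE mO EO.
have E'oo : (mu E' < +oo)%E by rewrite -muE.
have MD i j : mean_mx D E i j = (volume E)^-1 * Rintegral mu E' (fun x => D x i j).
  by rewrite mxE (Rintegral_conull cmu mE mO EO).
have vol0 : 0 < volume E by rewrite fine_gt0// E0.
have Dsym x : Omega x -> (D x)^T = D x by move/Dpos => [].
have Dpsd x : Omega x -> possemidef (D x).
  move=> /Dpos[Ds Dp]; split => // v.
  have [->|/Dp/ltW//] := eqVneq v 0; by rewrite !mul0mx mxE.
(* The upper bound on the form bounds the diagonal, and semidefiniteness then bounds every entry;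
   boundedness is what gives integrability on [E']. *)
have Dbd x i j : Omega x -> `|D x i j| <= dmax.
  move=> Ox; have := psd_entry (D x) i j (Dpsd x Ox).
  have [_ [_ P]] := Db x Ox.
  have {P}P k : D x k k <= dmax.
    have := P (delta_mx 0 k); rewrite -/(qform _ _) qform_delta !mxE eqxx.
    by rewrite subr_ge0.
  have := P i; have := P j => Pj Pi /le_trans; apply; lra.
have intD i j : mu.-integrable E' (EFin \o (fun x => D x i j)).
  apply: measurable_bounded_integrable => //.
  - by apply: measurable_funS (mD i j) => //; exact: subIsetr.
  - exists dmax; split; first exact: num_real.
    by move=> x dx y [_ Oy] /=; rewrite (le_trans _ (ltW dx))// Dbd.
split.
  apply/matrixP => i j; rewrite mxE !MD; congr (_ * _).
  apply: eq_Rintegral => x; rewrite inE => -[_ Ox].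
  by rewrite -[in LHS]Dsym// mxE.
move=> v; rewrite qformE.
have intv i j : mu.-integrable E' (EFin \o (fun x => v 0 i * v 0 j * D x i j)).
  exact: (integrableZl mE' (v 0 i * v 0 j) (intD i j)).
have -> : \sum_i \sum_j v 0 i * v 0 j * mean_mx D E i j =
    (volume E)^-1 * Rintegral mu E' (fun x => qform (D x) v).
  under [in RHS]eq_Rintegral do rewrite qformE.
  rewrite Rintegral_sum//; last by move=> i; exact: integrable_Rsum.
  rewrite mulr_sumr; apply: eq_bigr => i _.
  rewrite Rintegral_sum// mulr_sumr; apply: eq_bigr => j _.
  by rewrite RintegralZl// MD mulrCA.
rewrite ler_pdivlMl// (_ : volume E * _ = Rintegral mu E' (fun=> dmin * (v *m v^T) 0 0)).
  apply: le_Rintegral => //.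
  - apply: measurable_bounded_integrable => //.
    exact: bounded_cst.
  - under eq_fun do rewrite qformE.
    by apply: integrable_Rsum => // i; exact: integrable_Rsum.
  - move=> x [_ Ox]; have [[_ P] _] := Db x Ox.
    have := P v; rewrite mulmxBr mulmxBl mul_mx_scalar -scalemxAl.
    by rewrite mxE [X in _ + X]mxE [in X in _ - X]mxE subr_ge0.
by rewrite Rintegral_cst// mulrC; congr (_ * fine _).
Qed.

(** * Gradients of the hat functions on an element *)

Lemma affineD {R : realType} {d} (u : 'cV[R]_d * R) (x y : 'rV[R]_d) :
  affine u (x + y) = (x *m u.1) 0 0 + affine u y.
Proof. by rewrite /affine mulmxDl mxE addrA. Qed.

(** Derivatives are local, so at interior points [f] may be replaced by the affine function. An
    interior point also pins down the value chosen by [xget]; with empty interior every vector would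
    qualify. *)
Lemma grad_on_affine {R : realType} {d} (f : 'rV[R]_d -> R) (E : set 'rV[R]_d)
    (u : 'cV[R]_d * R) :
  interior E !=set0 -> (forall x, E x -> f x = affine u x) ->
  grad_on f E = u.1^T.
Proof.
move=> [z Ez] fE.
have gradf x : interior E x -> grad f x = u.1^T.
  move=> Ex; apply/rowP => i; rewrite !mxE.
  rewrite (near_eq_derive (g := affine u)); last first.
    by apply: filterS Ex => y; exact: fE.
  rewrite /derive; apply: cvg_lim => //.
  apply: (@cvg_trans _ (cst (u.1 i 0) @ 0^')); last exact: cvg_cst.
  apply: near_eq_cvg; near=> h.
  have h0 : h != 0 by near: h; exact: nbhs_dnbhs_neq.
  rewrite /cst /= affineD addrK -scalemxAl mxE -rowE mxE.
  by rewrite /GRing.scale/= mulKf.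
apply: xget_unique => [x|g gE]; first exact: gradf.
by rewrite -(gE z Ez) gradf.
Unshelve. all: by end_near. Qed.

Section hat.
Context {R : realType} {d : nat} {Omega : set 'rV[R]_d}.
Context {T : simplicial_mesh Omega} {i : 'I_(nvi T + nvb T)}.
Context {phi : 'rV[R]_d -> R} (hatphi : is_hat T i phi).
Context {K : {set 'I_(nvi T + nvb T)}} (KT : K \in elements T).

Lemma vertex_hull k : k \in K -> hull (vertex T) K (vertex T k).
Proof.
move=> kK; exists (fun l => (l == k)%:R); split.
- by move=> l _; rewrite ler0n.
- by rewrite (bigD1 k)//= eqxx big1 ?addr0// => l /andP[_ /negbTE ->].
- rewrite (bigD1 k)//= eqxx scale1r big1 ?addr0// => l /andP[_ /negbTE ->].
  by rewrite scale0r.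
Qed.

Lemma element_interior : interior (hull (vertex T) K) !=set0.
Proof.
have [u [_ //]] := hull_halfspaces _ (vertex T) K (element_card KT)
  (element_nondegenerate KT).
Qed.

Lemma hat_affine : exists u, forall x, hull (vertex T) K x -> phi x = affine u x.
Proof.
by have [_ /(_ K KT)[g [c gc]] _] := hatphi; exists (g, c) => x /gc.
Qed.

(** The hat function vanishes at every vertex of [K], hence on all of [K]. This gives the sparsity
    of the local matrices. *)
Lemma grad_on_hat_eq0 : i \notin K -> grad_on phi (hull (vertex T) K) = 0.
Proof.
move=> iK; have [u uP] := hat_affine; have [_ _ phiV] := hatphi.
rewrite (@grad_on_affine _ _ _ _ (0, 0)) ?trmx0//; first exact: element_interior.
move=> x Kx; rewrite uP// {2}/affine mulmx0 mxE addr0.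
have [a [_ a1 ->]] := Kx; rewrite affine_sum// big1// => k kK.
rewrite -uP; last exact: vertex_hull.
by rewrite phiV (negbTE (memPn iK _ kK)) mulr0.
Qed.

(** A zero gradient would make the hat function constant on [K], yet it is 1 at the vertex [i] and 0
    at another one, which exists as [1 <= d]. *)
Lemma grad_on_hat_neq0 : (1 <= d)%N -> i \in K ->
  grad_on phi (hull (vertex T) K) != 0.
Proof.
move=> d1 iK; have [u uP] := hat_affine; have [_ _ phiV] := hatphi.
rewrite (@grad_on_affine _ _ _ _ u)//; last exact: element_interior.
apply/eqP => /(congr1 trmx); rewrite trmxK trmx0 => u10.
have [k kK ki] : exists2 k, k \in K & k != i.
  have : (0 < #|K :\ i|)%N.
    by have := cardsD1 i K; rewrite iK (element_card KT) add1n => -[<-].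
  by move=> /card_gt0P[k]; rewrite !inE => /andP[]; exists k.
have c k' : k' \in K -> (k' == i)%:R = u.2.
  move=> k'K; rewrite -phiV uP; last exact: vertex_hull.
  by rewrite /affine u10 mulmx0 mxE add0r.
by have := c _ iK; rewrite -(c _ kK) eqxx (negbTE ki) => /eqP; rewrite oner_eq0.
Qed.

End hat.

(** * Local stiffness matrices and the spectral bounds *)

(** With [a i = v_i^2 A_ii], each pair in [J] contributes at most [(a i + a j) / 2]; over all pairs,
    each [a i] gets total weight [#|J|]. *)
Lemma psd_sparse_le {R : realType} {n} (A : 'M[R]_n) (J : {set 'I_n}) v :
  possemidef A -> (forall i j, i \notin J -> A i j = 0) ->
  qform A v <= #|J|%:R * \sum_i v 0 i ^+ 2 * A i i.
Proof.
move=> Apsd AJ; rewrite qformE.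
have sJ (F : 'I_n -> R) : (forall i, i \notin J -> F i = 0) ->
    \sum_i F i = \sum_(i in J) F i.
  by move=> F0; rewrite (bigID (mem J))/= [X in _ + X]big1 ?addr0.
have AJ' i j : j \notin J -> A i j = 0.
  by move=> jJ; rewrite -[A]Apsd.1 mxE AJ.
pose a i := v 0 i ^+ 2 * A i i; pose s := \sum_(i in J) a i.
have -> : \sum_i v 0 i ^+ 2 * A i i = s.
  by apply: sJ => i iJ; rewrite AJ// mulr0.
rewrite sJ; last by move=> i iJ; rewrite big1// => j _; rewrite AJ// mulr0.
apply: (@le_trans _ _ (\sum_(i in J) \sum_(j in J)
    (a i + a j) / 2)).
  apply: ler_sum => i _; rewrite sJ; last by move=> j jJ; rewrite AJ' ?mulr0.
  by apply: ler_sum => j _; rewrite /a psd_entry_le.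
rewrite (eq_bigr (fun i => (#|J|%:R * a i + s) / 2)) => [|i _]; last first.
  by rewrite -mulr_suml big_split/= sumr_const -[X in X + _]mulr_natl.
rewrite -mulr_suml big_split/= sumr_const -mulr_sumr -/s -[X in _ + X]mulr_natl.
by rewrite mulrDl -splitr.
Qed.

(** Kept at full size, so that assembly is a plain sum over the elements. *)
Definition local_stiffness {R : realType} {d n} (E : set 'rV[R]_d)
    (D : 'rV[R]_d -> 'M[R]_d) (phi : 'I_n -> 'rV[R]_d -> R) : 'M[R]_n :=
  \matrix_(i, j) (volume E *
    (grad_on (phi i) E *m mean_mx D E *m (grad_on (phi j) E)^T) 0 0).

(** For hat functions on an element, the vector on the right is the gradient of the finite element
    function with nodal values [v]. Semidefiniteness thus passes from the mean matrix to the local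
    one. *)
Lemma qform_local_stiffness {R : realType} {d n} (E : set 'rV[R]_d)
    (D : 'rV[R]_d -> 'M[R]_d) (phi : 'I_n -> 'rV[R]_d -> R) v :
  qform (local_stiffness E D phi) v =
  volume E * qform (mean_mx D E) (\sum_i v 0 i *: grad_on (phi i) E).
Proof.
rewrite qformE [in RHS]/qform linear_sum/= !mulmx_suml summxE mulr_sumr.
apply: eq_bigr => i _; rewrite mulmx_sumr summxE mulr_sumr.
apply: eq_bigr => j _; rewrite mxE linearZ/= -!scalemxAl -scalemxAr !mxE.
ring.
Qed.

(** One weighted bound serves twice: bounding each weight by the maximum gives the first estimate,
    and substituting [v *m invmx S] for [v] turns the weights into 1. The default [A j0 j0] is a
    diagonal entry, so [maxdiag] is the true maximum. *)
Lemma largest_eigenvalue_jacobi {R : realType} {n} (A : 'M[R]_n) (j0 : 'I_n)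
    (c : R) :
  A^T = A -> (forall j, 0 < A j j) -> 0 <= c ->
  (forall v, qform A v <= c * \sum_i v 0 i ^+ 2 * A i i) ->
  let maxdiag := \big[Num.max/A j0 j0]_j A j j in
  let S := diag_mx (\row_j Num.sqrt (A j j)) in
  (exists2 lam, largest_eigenvalue A lam & maxdiag <= lam <= c * maxdiag) /\
  (exists2 lam, largest_eigenvalue (invmx S *m A *m invmx S) lam &
     1 <= lam <= c).
Proof.
move=> As A0 c0 Ac maxdiag S; split.
  have [|lam evl [Al lc]] := largest_eigenvalue_bounds A j0 (c * maxdiag) As.
    move=> v; apply: (le_trans (Ac v)); rewrite -mulrA ler_wpM2l// sqnormE.
    rewrite mulr_sumr ler_sum// => i _; rewrite mulrC ler_wpM2r ?sqr_ge0//.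
    exact: (le_bigmax _ (fun j => A j j)).
  by exists lam => //; rewrite lc andbT; apply/bigmax_leP; split.
pose V : 'M[R]_n := diag_mx (\row_j (Num.sqrt (A j j))^-1).
have s0 j : 0 < Num.sqrt (A j j) by rewrite sqrtr_gt0.
have SV : S *m V = 1%:M.
  rewrite /S /V mulmx_diag -diag_const_mx; congr diag_mx.
  by apply/rowP => j; rewrite !mxE mulfV// gt_eqF.
have -> : invmx S = V.
  by rewrite -[RHS]mul1mx -(mulVmx (mulmx1_unit SV).1) -mulmxA SV mulmx1.
have VT : V^T = V by rewrite tr_diag_mx.
set B := V *m A *m V.
have BE i j : B i j = A i j / (Num.sqrt (A i i) * Num.sqrt (A j j)).
  by rewrite /B /V mul_mx_diag mul_diag_mx !mxE invfM; ring.
have BT : B^T = B by rewrite !trmx_mul VT As mulmxA.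
have [|lam evl [Bl lc]] := largest_eigenvalue_bounds B j0 c BT.
  move=> v; have -> : qform B v = qform A (v *m V).
    by rewrite /qform trmx_mul VT !mulmxA.
  apply: (le_trans (Ac _)); rewrite ler_wpM2l// sqnormE ler_sum// => i _.
  rewrite /V mul_mx_diag !mxE exprMn exprVn (sqr_sqrtr (ltW (A0 i))).
  by rewrite mulfVK// gt_eqF.
(* The preconditioned matrix has unit diagonal, whence the lower bound 1. *)
exists lam => //; rewrite lc andbT; have := Bl j0; rewrite BE -expr2.
by rewrite (sqr_sqrtr (ltW (A0 j0))) mulfV// gt_eqF.
Qed.

(** * Assembly over the mesh *)

Theorem lemma4p1 (R : realType) (d : nat) (Omega : set 'rV[R]_d)
    (D : 'rV[R]_d -> 'M[R]_d) (dmin dmax : R)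
    (T : simplicial_mesh Omega) (phi : 'I_(nvi T) -> 'rV[R]_d -> R)
    (j0 : 'I_(nvi T)) :
  (1 <= d)%N ->
  is_domain Omega -> simply_connected R Omega -> polyhedral Omega ->
  0 < dmin -> 0 < dmax ->
  (forall i j, measurable_fun (Omega : set (lebesgue_space R d))
                 (fun x : lebesgue_space R d => D x i j)) ->
  (forall x, Omega x -> posdef (D x)) ->
  (forall x, Omega x -> possemidef (D x - dmin%:M) /\
                        possemidef (dmax%:M - D x)) ->
  (forall j, is_hat T (lshift (nvb T) j) (phi j)) ->
  let A := stiffness T D phi in
  let maxdiag := \big[Num.max/A j0 j0]_j A j j in
  let S := diag_mx (\row_j Num.sqrt (A j j)) in
  (exists2 lam, largest_eigenvalue A lam &
     maxdiag <= lam <= d.+1%:R * maxdiag) /\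
  (exists2 lam, largest_eigenvalue (invmx S *m A *m invmx S) lam &
     1 <= lam <= d.+1%:R).
Proof.
move=> d1 [oO _ _] _ pO dmin0 _ mD Dpos Db hat A.
have mO := lebesgue_measurable_domain Omega T d1 oO pO.
have nB := polyhedral_boundary_negligible Omega d1 pO.
pose E K := hull (vertex T) K.
pose A_ K := local_stiffness (E K) D phi.
have AE : A = \sum_(K in elements T) A_ K.
  apply/matrixP => i j; rewrite mxE summxE; apply: eq_bigr => K _.
  by rewrite mxE.
have volE K : K \in elements T -> (0 < @lebesgue_rV R d (E K) < +oo)%E.
  move=> KT; have cK := element_card KT; have aK := element_nondegenerate KT.
  rewrite hull_lebesgue_lty// andbT interior_lebesgue_gt0//.
    exact: measurable_hull.
  exact: element_interior.
have vol0 K : K \in elements T -> 0 < volume (E K).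
  by move=> /volE; exact: fine_gt0.
have meanE K : K \in elements T -> (mean_mx D (E K))^T = mean_mx D (E K) /\
    forall v, dmin * (v *m v^T) 0 0 <= qform (mean_mx D (E K)) v.
  move=> KT; apply: (mean_mx_elliptic Omega _ D dmin dmax) => //.
  - apply: lebesgue_measurable; apply: measurable_hull.
      exact: element_card.
    exact: element_nondegenerate.
  - exact: volE.
  (* A point of an element outside [Omega] is in the closure but not in the interior of [Omega],
     that is, in the null boundary. *)
  - have [N [mN N0 BN]] := nB; exists N; split=> // x [Kx Ox]; apply: BN; split.
      by rewrite (mesh_cover T); exists K.
    by rewrite (interior_id _).1.
have A_psd K : K \in elements T -> possemidef (A_ K).
  move=> KT; have [Ms M0] := meanE K KT; split.
    by apply/matrixP => i j; rewrite mxE [LHS]mxE [RHS]mxE bilin_sym.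
  move=> v; rewrite -/(qform _ _) qform_local_stiffness.
  rewrite mulr_ge0 ?(ltW (vol0 _ _))//; apply: le_trans (M0 _).
  by rewrite mulr_ge0 ?sqnorm_ge0// ltW.
have A_ge0 K j : K \in elements T -> 0 <= A_ K j j.
  by move=> KT; rewrite -qform_delta; exact: (A_psd K KT).2.
apply: largest_eigenvalue_jacobi.
- rewrite AE linear_sum/=; apply: eq_bigr => K KT; exact: (A_psd K KT).1.
- move=> j; have [K KT jK] := vertex_in_element (lshift (nvb T) j).
  rewrite AE summxE (bigD1 K)//= ltr_wpDr//.
    by rewrite sumr_ge0// => L /andP[LT _]; exact: A_ge0.
  rewrite mxE mulr_gt0 ?vol0//; apply: lt_le_trans ((meanE K KT).2 _).
  by rewrite mulr_gt0// sqnorm_gt0//; exact: (grad_on_hat_neq0 (hat j) KT).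
- by [].
move=> v.
have -> : qform A v = \sum_(K in elements T) qform (A_ K) v.
  by rewrite /qform AE mulmx_sumr mulmx_suml summxE.
have -> : \sum_i v 0 i ^+ 2 * A i i =
    \sum_(K in elements T) \sum_i v 0 i ^+ 2 * A_ K i i.
  rewrite exchange_big/=; apply: eq_bigr => i _.
  by rewrite AE summxE mulr_sumr.
rewrite mulr_sumr; apply: ler_sum => K KT.
(* Only the interior vertices of [K] index the matrix, so [#|J|] is at most [d + 1] and smaller when
   [K] has boundary vertices. *)
pose J := [set i | lshift (nvb T) i \in K]%SET.
apply: (@le_trans _ _ (#|J|%:R * \sum_i v 0 i ^+ 2 * A_ K i i)).
  apply: psd_sparse_le; first exact: A_psd.
  move=> i j; rewrite inE => iK; rewrite mxE.
  by rewrite (grad_on_hat_eq0 (hat i) KT iK) !mul0mx mxE mulr0.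
rewrite ler_wpM2r//.
  by rewrite sumr_ge0// => i _; rewrite mulr_ge0 ?sqr_ge0 ?A_ge0.
rewrite ler_nat -(element_card KT) -(card_imset J (@lshift_inj (nvi T) (nvb T))).
apply: subset_leq_card; apply/fintype.subsetP => _ /imsetP[i + ->].
by rewrite inE.
Qed.
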